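(* Let $\mathcal{D}$ be a dyadic grid on $\mathbb{R}$ containing the interval $I^{(0)}=(-1,0)$ (up to endpoints), and for $k\geq1$ let $I^{(k)}$ be the right dyadic child (right half) of $I^{(k-1)}$. The space $H^{1/2}_{\mathcal{D}}(\mathbb{R})$ is not an algebra (that is, it is not closed under pointwise multiplication). In particular, for any $1<\alpha\leq 3/2$, the function $$f:=\sum_{k>0}\frac{1}{2^{k/2}k^{\alpha/2}}h_{I^{(k)}}$$ belongs to $H^{1/2}_{\mathcal{D}}(\mathbb{R})$ while $f^2\notin H^{1/2}_{\mathcal{D}}(\mathbb{R})$.
   Context: A dyadic grid $\mathcal{D}$ on $\mathbb{R}$ is a collection of intervals such that: (D1) every $I\in\mathcal{D}$ has length $2^k$ for some $k\in\mathbb{Z}$; (D2) for any fixed $k_0\in\mathbb{Z}$, the intervals of $\mathcal{D}$ of length $2^{k_0}$ form a partition of $\mathbb{R}$; (D3) $I\cap J\in\{\varnothing,I,J\}$ for all $I,J\in\mathcal{D}$. $|\cdot|$ denotes Lebesgue measure. For $I\in\mathcal{D}$, $I_+$ and $I_-$ denote the right and left halves of $I$ (the two elements of $\mathcal{D}$ of length $|I|/2$ contained in $I$), and $h_I:=|I|^{-1/2}(\mathbf{1}_{I_+}-\mathbf{1}_{I_-})$ is the Haar function; $\{h_I\}_{I\in\mathcal{D}}$ is an orthonormal basis of $L^2(\mathbb{R})$, and Haar series are understood in $L^2(\mathbb{R})$. With $(f,g):=\int_{\mathbb{R}}fg\,dx$, the space $H^{1/2}_{\mathcal{D}}(\mathbb{R})$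 consists of all $f\in L^2(\mathbb{R})$ with $\sum_{I\in\mathcal{D}}|I|^{-1}|(f,h_I)|^2<\infty$. *)

(* Defs.v *)
From HB Require Import structures.
From mathcomp Require Import all_boot all_order all_algebra.
From mathcomp Require Import all_classical all_reals all_analysis.

Set Implicit Arguments.
Unset Strict Implicit.
Unset Printing Implicit Defensive.

Import Order.TTheory GRing.Theory Num.Theory.
Import numFieldNormedType.Exports.

Local Open Scope classical_set_scope.
Local Open Scope ring_scope.

Section HaarSobolev.
Context {R : realType}.
Implicit Types (D : set (set R)) (I J K : set R) (f g : R -> R).

Let mu : set (measurableTypeR R) -> \bar R := @lebesgue_measure R.

(* No endpoint convention is imposed on the intervals of a grid. *)
Definition dyadic_grid D : Prop :=
  [/\ forall I, D I -> is_interval I /\ exists k : int, mu I = (2 ^ k)%:E,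
      forall k : int, partition [set I | D I /\ mu I = (2 ^ k)%:E] id setT
    & forall I J, D I -> D J ->
        [\/ I `&` J = set0, I `&` J = I | I `&` J = J]].

Definition dyadic_children D I : set (set R) :=
  [set J | [/\ D J, J `<=` I & mu J = ((2^-1)%:E * mu I)%E]].

(* When D is a grid and I belongs to D, there are exactly two children, each
   half is uniquely determined, and the default value set0 is not used. *)
Definition right_half D I : set R :=
  xget set0 [set J | dyadic_children D I J /\
    forall K, dyadic_children D I K -> K <> J ->
      forall x y, K x -> J y -> x < y].

Definition left_half D I : set R :=
  xget set0 [set J | dyadic_children D I J /\
    forall K, dyadic_children D I K -> K <> J ->
      forall x y, J x -> K y -> x < y].

Definition haar D I : R -> R := fun x =>
  fine (mu I) `^ (- 2^-1) * (\1_(right_half D I) x - \1_(left_half D I) x).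

Definition L2 : set (measurableTypeR R -> R) :=
  [set f | f \in Lfun (@lebesgue_measure R) 2%:E].

Definition inner f g : R :=
  (\int[@lebesgue_measure R]_(x in [set: R]) (f x * g x))%R.

(* Elements of L2 are represented by Borel functions R -> R, not by classes
   modulo almost everywhere equality. *)
Definition Hhalf D : set (R -> R) :=
  [set f | L2 f /\
    (\esum_(I in D) (((fine (mu I))^-1 * `|inner f (haar D I)| ^+ 2)%:E)
       < +oo)%E].

(* f is (a representative of) the sum in L2 of the series
   u 1 + u 2 + u 3 + ... ; the term u 0 is not part of the series. *)
Definition L2_sum (u : nat -> R -> R) f : Prop :=
  L2 f /\
  (fun n => Lnorm (@lebesgue_measure R) 2%:E
     (fun x => (f x - \sum_(1 <= k < n.+1) u k x)%:E)) @ \oo --> 0%E.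

End HaarSobolev.

(* Main.v *)
Require Import Defs.
From HB Require Import structures.
From mathcomp Require Import all_boot all_order all_algebra.
From mathcomp Require Import all_classical all_reals all_analysis.
From mathcomp Require Import measurable_realfun ring lra zify.
Set Implicit Arguments.
Unset Strict Implicit.
Unset Printing Implicit Defensive.
Import Order.TTheory GRing.Theory Num.Theory.
Import numFieldNormedType.Exports.
Local Open Scope classical_set_scope.
Local Open Scope ring_scope.

(** Write [a k = k^(-alpha/2)], so that the [k]-th term of the series is [a k]
    on the right half of [I k], [- a k] on its left half and [0] elsewhere, and
    let [S k] be the sum of the [a j] for [1 <= j < k].

    The Haar functions of a grid are orthonormal, since a grid interval that is
    strictly contained in another one lies in one of its halves, where the
    larger Haar function is constant.  Hence the only nonzero Haar coefficients
    of [f] are those of the series, and the sum defining [Hhalf] is the sum of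
    the [a k ^ 2 = k^(-alpha)], which is finite because [1 < alpha].

    Up to a null set, [I k] is the union of the left halves of the [I m] with
    [k <= m], and [f] is almost everywhere equal to [S m - a m] on the left half
    of [I m].  As [a] is nonincreasing, [f] is at least [S k] on the right half
    of [I k], while it equals [S k - a k] on the left half.  So for [2 <= k] the
    jump of [f ^ 2] across the middle of [I k] is at least
    [S k ^ 2 - (S k - a k) ^ 2 = a k * (2 * S k - a k) >= (k - 1) * a k ^ 2],
    and the contribution of [I k] to the sum defining [Hhalf] for [f ^ 2] is at
    least a quarter of the square of this quantity.  It is of order
    [k^(2 - 2 * alpha)], and [2 - 2 * alpha >= -1]: the sum is infinite, by
    comparison with the harmonic series ([inner_sqr_lower], [chain_sqr_Hhalf],
    [powR_series_unbounded]).

    The series converges in L2 because its terms are bounded by the indicators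
    of the [I k], whose measures decrease geometrically: the partial sums are
    stationary almost everywhere and the tails are explicitly small
    ([nested_L2_sum]).

    The failure of the algebra property is the case [alpha = 3/2]. *)

(** * Halves of the intervals of a dyadic grid *)

Section grid.
Context (R : realType) (D : set (set R)).
Hypothesis hD : dyadic_grid D.
Local Notation mu := (@lebesgue_measure R).

Lemma grid_measurable J : D J -> measurable J.
Proof.
by case: hD => h _ _ /h[Ji _]; exact: is_interval_measurable.
Qed.

Lemma grid_measure J : D J -> exists k : int, mu J = (2 ^ k)%:E.
Proof. by case: hD => h _ _ /h[]. Qed.

Lemma grid_measure_gt0 J : D J -> (0 < mu J)%E.
Proof. by move=> /grid_measure[k ->]; rewrite lte_fin exprz_gt0. Qed.

Lemma grid_measure_fin J : D J -> mu J \is a fin_num.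
Proof. by move=> /grid_measure[k ->]. Qed.

Lemma grid_eq J K x : D J -> D K -> mu J = mu K -> J x -> K x -> J = K.
Proof.
move=> DJ DK eqJK Jx Kx; have [k muJ] := grid_measure DJ.
case: hD => _ /(_ k)[_ + _] _; apply => //=; first by split=> //; rewrite -eqJK.
by exists x.
Qed.

Lemma child_exists J x : D J -> J x -> exists2 K, dyadic_children D J K & K x.
Proof.
move=> DJ Jx; have [k muJ] := grid_measure DJ.
case: hD => _ /(_ (k - 1))[cov _ _] tri.
have : [set: R] x by [].
rewrite -cov => -[K [DK muK] Kx]; exists K => //.
have muK2 : mu K = (2^-1%:E * mu J)%E.
  by rewrite muK muJ -EFinM expfzDr// mulrC.
split => //; case: (tri J K DJ DK) => [JK0|JKJ|JKK].
- by have : (J `&` K) x by []; rewrite JK0.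
- have : (mu J <= mu K)%E.
    apply: le_measure; rewrite ?inE; try exact: grid_measurable.
    by rewrite -JKJ; exact: subIsetr.
  rewrite muK2 muJ -EFinM lee_fin.
  by have : (0 : R) < 2 ^ k := exprz_gt0 k (ltr0n _ 2); lra.
- by rewrite -JKK; exact: subIsetl.
Qed.

Lemma child_eq J K K' x :
  dyadic_children D J K -> dyadic_children D J K' -> K x -> K' x -> K = K'.
Proof.
by move=> [DK _ mK] [DK' _ mK']; apply: grid_eq => //; rewrite mK mK'.
Qed.

(** Two disjoint children carry the full measure of the parent, so there is no
    room left for a third one, which would have positive measure. *)
Lemma children_cover J K K' : D J ->
  dyadic_children D J K -> dyadic_children D J K' -> K `&` K' = set0 ->
  K `|` K' = J.
Proof.
move=> DJ cK cK' KK'; have [DK KJ mK] := cK; have [DK' K'J mK'] := cK'.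
apply/seteqP; split => [x [/KJ|/K'J]//|x Jx]; apply: contrapT => nKx.
have [L cL Lx] := child_exists DJ Jx; have [DL LJ mL] := cL.
have dis A : dyadic_children D J A -> ~ A x -> L `&` A = set0.
  move=> cA nAx; apply/seteqP; split => // y [Ly Ay]; apply: nAx.
  by rewrite -(child_eq cL cA Ly Ay).
have LK0 : L `&` K = set0 by apply: dis => // ?; apply: nKx; left.
have LK'0 : L `&` K' = set0 by apply: dis => // ?; apply: nKx; right.
have mea := grid_measurable.
have : (mu (L `|` (K `|` K')) <= mu J)%E.
  apply: le_measure; rewrite ?inE; try exact: mea.
    by do 2 (apply: measurableU; first exact: mea); exact: mea.
  by move=> y [/LJ|[/KJ|/K'J]].
rewrite measureU; [|exact: mea|by apply: measurableU; exact: mea|].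
  rewrite measureU; [|exact: mea|exact: mea|by[]].
  have [k muJ] := grid_measure DJ.
  rewrite /= mL mK mK' muJ -!EFinM -!EFinD lee_fin.
  by have : (0 : R) < 2 ^ k := exprz_gt0 k (ltr0n _ 2); lra.
by rewrite setIUr LK0 LK'0 setU0.
Qed.

(** The definitions of [right_half] and [left_half] are choices with default
    value [set0].  They are meaningful because the children of [J] are exactly
    two disjoint intervals, one of which lies entirely to the left of the
    other. *)
Lemma grid_halves J : D J ->
  [/\ dyadic_children D J (right_half D J),
      dyadic_children D J (left_half D J),
      right_half D J `&` left_half D J = set0 &
      right_half D J `|` left_half D J = J].
Proof.
move=> DJ.
suff [K [L [cK cL ltLK]]] : exists K L, [/\ dyadic_children D J K,
    dyadic_children D J L & forall x y, L x -> K y -> x < y].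
  have dis : K `&` L = set0.
    apply/seteqP; split => // x [Kx Lx].
    by have := ltLK _ _ Lx Kx; rewrite ltxx.
  have ne A : dyadic_children D J A -> exists x, A x.
    move=> [DA _ _]; apply/set0P/eqP => A0; have := grid_measure_gt0 DA.
    by rewrite A0 measure0 ltxx.
  have only A : dyadic_children D J A -> A = K \/ A = L.
    move=> cA; have [x Ax] := ne _ cA; have [_ + _] := cA.
    move=> /(_ _ Ax); rewrite -(children_cover DJ cK cL dis) => -[Kx|Lx].
      by left; exact: (child_eq cA cK Ax Kx).
    by right; exact: (child_eq cA cL Ax Lx).
  have neq : K <> L.
    move=> KL; have [x Kx] := ne _ cK; move: dis.
    by rewrite -KL setIid => K0; rewrite K0 in Kx.
  have -> : right_half D J = K.
    apply: xget_unique => [|A [/only[->//|->]]].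
      by split=> // A /only[->//|->] _; exact: ltLK.
    move=> /(_ _ cK neq); have [[x Kx] [y Ly]] := (ne _ cK, ne _ cL).
    by move=> /(_ _ _ Kx Ly); rewrite ltNge (ltW (ltLK _ _ Ly Kx)).
  have -> : left_half D J = L.
    apply: xget_unique => [|A [/only[->|->//]]].
      by split=> // A /only[->|->//] _; exact: ltLK.
    move=> /(_ _ cL (nesym neq)); have [[x Kx] [y Ly]] := (ne _ cK, ne _ cL).
    by move=> /(_ _ _ Kx Ly); rewrite ltNge (ltW (ltLK _ _ Ly Kx)).
  by split=> //; exact: children_cover.
have [x Jx] : exists x, J x.
  apply/set0P/eqP => J0; have := grid_measure_gt0 DJ.
  by rewrite J0 measure0 ltxx.
have [K cK Kx] := child_exists DJ Jx; have [DK KJ mK] := cK.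
have [y [Jy nKy]] : exists y, J y /\ ~ K y.
  apply: contrapT => h; have JK : J `<=` K.
    by move=> y Jy; apply: contrapT => nKy; apply: h; exists y.
  have : (mu J <= mu K)%E.
    by apply: le_measure; rewrite ?inE//; exact: grid_measurable.
  have [k muJ] := grid_measure DJ; rewrite mK muJ -EFinM lee_fin.
  by have : (0 : R) < 2 ^ k := exprz_gt0 k (ltr0n _ 2); lra.
have [L cL Ly] := child_exists DJ Jy; have [DL LJ mL] := cL.
have dis z : K z -> L z -> False.
  by move=> Kz Lz; apply: nKy; rewrite (child_eq cK cL Kz Lz).
have [[iK _] [iL _]] : (is_interval K /\ exists k : int, mu K = (2 ^ k)%:E) /\
   (is_interval L /\ exists k : int, mu L = (2 ^ k)%:E).
  by case: hD => h _ _; split; exact: h.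
(* disjoint intervals are ordered like any two of their points *)
have ord (A B : set R) a b : is_interval A -> is_interval B ->
    (forall z, A z -> B z -> False) -> A a -> B b -> a < b ->
    forall s t, A s -> B t -> s < t.
  move=> iA iB AB Aa Bb ab s t As Bt; rewrite ltNge; apply/negP => ts.
  have [sb|bs] := leP s b.
    have [ta|/ltW a_t] := leP t a.
      by apply: (AB a) => //; apply: (iB t b) => //; rewrite ta ltW.
    by apply: (AB t) => //; apply: (iA a s) => //; rewrite a_t.
  by apply: (AB b) => //; apply: (iA a s) => //; rewrite !ltW.
have [xy|yx|xy] := ltgtP x y.
- by exists L, K; split=> //; exact: (ord K L x y).
- exists K, L; split=> //; apply: (ord L K y x) => // z Lz Kz.
  exact: (dis z).
- by exfalso; apply: (dis x) => //; rewrite xy.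
Qed.

End grid.

(** * Square-integrable functions *)

Section L2_facts.
Context d (T : measurableType d) (R : realType).
Variable mu : {measure set T -> \bar R}.
Implicit Types f g : T -> R.

Lemma Lnorm2E f :
  Lnorm mu 2%:E (EFin \o f) = ((\int[mu]_x (f x ^+ 2)%:E) `^ 2^-1)%E.
Proof.
rewrite unlock; congr poweR; apply: eq_integral => x _ /=.
by rewrite powR_mulrn// real_normK ?num_real.
Qed.

Lemma Lfun2P f : f \in Lfun mu 2%:E <->
  measurable_fun [set: T] f /\ (\int[mu]_x (f x ^+ 2)%:E < +oo)%E.
Proof.
rewrite inE; split=> [/andP[]|[mf foo]].
  rewrite !inE/= => mf; rewrite /finite_norm Lnorm2E => foo; split=> //.
  by apply: lty_poweRy foo; rewrite invr_neq0.
apply/andP; rewrite !inE/=; split=> //.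
by rewrite /finite_norm Lnorm2E poweR_lty.
Qed.

Lemma integrable_indic_fin (A : set T) : measurable A -> (mu A < +oo)%E ->
  mu.-integrable [set: T] (EFin \o \1_A).
Proof.
move=> mA Aoo; apply/integrableP; split.
  by apply/measurable_EFinP; exact: measurable_indic.
under eq_integral do rewrite /= ger0_norm//.
by rewrite integral_indic// setIT.
Qed.

Lemma integral_scale_indic (c : R) (A : set T) : 0 <= c -> measurable A ->
  (\int[mu]_x (c * \1_A x)%:E = c%:E * mu A)%E.
Proof.
move=> c0 mA; under eq_integral do rewrite EFinM.
rewrite ge0_integralZl// ?integral_indic// ?setIT//.
by apply/measurable_EFinP; exact: measurable_indic.
Qed.

Lemma Rintegral_indic (A : set T) : measurable A ->
  (\int[mu]_x \1_A x)%R = fine (mu A).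
Proof. by move=> mA; rewrite /Rintegral integral_indic// setIT. Qed.

Lemma Lnorm2_eq0 f : measurable_fun [set: T] f ->
  Lnorm mu 2%:E (EFin \o f) = 0%E -> {ae mu, forall x, f x = 0}.
Proof.
move=> /measurable_EFinP mf /(Lnorm_eq0_eq0 mf).
rewrite lte_fin => /(_ (ltr0n _ 2)).
by apply: filterS => x /= /(_ I)[].
Qed.

Lemma Lfun2D f g : f \in Lfun mu 2%:E -> g \in Lfun mu 2%:E ->
  (fun x => f x + g x) \in Lfun mu 2%:E.
Proof. by move=> l2f l2g; exact: (Lfun_addr_closed mu (lee1n 2)).2. Qed.

Lemma Lfun2Z a f : f \in Lfun mu 2%:E -> (fun x => a * f x) \in Lfun mu 2%:E.
Proof.
move=> /(Lfun_scale a); rewrite ler1n => /(_ isT).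
by rewrite (_ : (fun x => _) = a \o* f)//; apply/funext => x /=; rewrite mulrC.
Qed.

Lemma Lfun2B f g : f \in Lfun mu 2%:E -> g \in Lfun mu 2%:E ->
  (fun x => f x - g x) \in Lfun mu 2%:E.
Proof. by move=> l2f /Lfun_oppr_closed; exact: Lfun2D. Qed.

Lemma Lfun2_sum (u : nat -> T -> R) n : (forall k, u k \in Lfun mu 2%:E) ->
  (fun x => \sum_(1 <= k < n.+1) u k x) \in Lfun mu 2%:E.
Proof.
move=> l2u; elim: n => [|n IH].
  under [X in X \in _]eq_fun do rewrite big_geq//.
  exact: (Lfun_addr_closed mu (lee1n 2)).1.
under [X in X \in _]eq_fun do rewrite big_nat_recr//=.
exact: Lfun2D.
Qed.

Lemma integrable_mul_Lfun2 f g : f \in Lfun mu 2%:E -> g \in Lfun mu 2%:E ->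
  mu.-integrable [set: T] (EFin \o (fun x => f x * g x)).
Proof. by move=> l2f l2g; exact/Lfun1_integrable/Lfun2_mul_Lfun1. Qed.

Lemma integrable_on (A : set T) g : measurable A ->
  mu.-integrable [set: T] (EFin \o g) -> mu.-integrable A (EFin \o g).
Proof. by move=> mA; apply: integrableS. Qed.

(** With [c] the height of a Haar function, this is the Haar coefficient of [g]
    as a difference of integrals over the two halves. *)
Lemma Rintegral_indicB (A B : set T) (c : R) g : measurable A -> measurable B ->
  mu.-integrable [set: T] (EFin \o g) ->
  (\int[mu]_x (g x * (c * (\1_A x - \1_B x))))%R =
  c * ((\int[mu]_(x in A) g x)%R - (\int[mu]_(x in B) g x)%R).
Proof.
move=> mA mB ig; rewrite (Rintegral_mkcond _ A) (Rintegral_mkcond _ B).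
have ion C : measurable C -> mu.-integrable setT (EFin \o (g \_ C)).
  move=> mC; rewrite -restrict_EFin; apply/(integrable_mkcond _ mC).
  exact: integrable_on.
have iAB := integrableB measurableT (ion _ mA) (ion _ mB).
rewrite -RintegralB//; try exact: ion.
rewrite -RintegralZl//; apply: eq_Rintegral => x _.
by rewrite !patch_indic /=; ring.
Qed.

(** The Cauchy-Schwarz inequality. *)
Lemma normr_inner_le f g : f \in Lfun mu 2%:E -> g \in Lfun mu 2%:E ->
  (`|(\int[mu]_x (f x * g x))%R|%:E <=
   Lnorm mu 2%:E (EFin \o f) * Lnorm mu 2%:E (EFin \o g))%E.
Proof.
move=> l2f l2g; have ifg := integrable_mul_Lfun2 l2f l2g.
move: l2f l2g => /Lfun2P[mf _] /Lfun2P[mg _].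
rewrite EFin_normr_Rintegral//.
apply: (le_trans (le_abse_integral _ _ _)) => //.
  by case/integrableP: ifg.
rewrite -Lnorm1; apply: (@hoelder _ _ _ _ _ _ 2 2) => //.
by rewrite [RHS]splitr !div1r.
Qed.

End L2_facts.

(** * Orthonormality of the Haar functions *)

Section haar.
Context (R : realType) (D : set (set R)).
Hypothesis hD : dyadic_grid D.
Local Notation mu := (@lebesgue_measure R).

Let c J := fine (mu J) `^ (- 2^-1).

Lemma grid_fine_gt0 J : D J -> 0 < fine (mu J).
Proof.
move=> DJ.
by rewrite fine_gt0// (grid_measure_gt0 hD)//= ltey_eq (grid_measure_fin hD).
Qed.

Lemma right_half_grid J : D J -> D (right_half D J).
Proof. by move=> /(grid_halves hD)[[]]. Qed.

Lemma left_half_grid J : D J -> D (left_half D J).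
Proof. by move=> /(grid_halves hD)[_ []]. Qed.

Lemma right_half_sub J : D J -> right_half D J `<=` J.
Proof. by move=> /(grid_halves hD)[[]]. Qed.

Lemma left_half_sub J : D J -> left_half D J `<=` J.
Proof. by move=> /(grid_halves hD)[_ []]. Qed.

Lemma fine_right_half J : D J ->
  fine (mu (right_half D J)) = 2^-1 * fine (mu J).
Proof.
move=> DJ; have [[_ _ ->] _ _ _] := grid_halves hD DJ.
by rewrite fineM// (grid_measure_fin hD).
Qed.

Lemma fine_left_half J : D J ->
  fine (mu (left_half D J)) = 2^-1 * fine (mu J).
Proof.
move=> DJ; have [_ [_ _ ->] _ _] := grid_halves hD DJ.
by rewrite fineM// (grid_measure_fin hD).
Qed.

Lemma haar_right J x : D J -> right_half D J x -> haar D J x = c J.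
Proof.
move=> DJ rx; have [_ _ dis _] := grid_halves hD DJ.
rewrite /haar !indicE mem_set// memNset ?subr0 ?mulr1// => lx.
by have : (right_half D J `&` left_half D J) x by []; rewrite dis.
Qed.

Lemma haar_left J x : D J -> left_half D J x -> haar D J x = - c J.
Proof.
move=> DJ rx; have [_ _ dis _] := grid_halves hD DJ.
rewrite /haar !indicE [x \in left_half _ _]mem_set// memNset.
  by rewrite sub0r mulrN1.
move=> lx.
by have : (right_half D J `&` left_half D J) x by []; rewrite dis.
Qed.

Lemma haar_out J x : D J -> ~ J x -> haar D J x = 0.
Proof.
move=> DJ nJ; rewrite /haar !indicE !memNset ?subrr ?mulr0//.
- by move/(left_half_sub DJ).
- by move/(right_half_sub DJ).
Qed.

Lemma haar_height_sqr J : D J -> c J ^+ 2 = (fine (mu J))^-1.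
Proof.
move=> DJ; rewrite /c -powR_mulrn ?powR_ge0// -powRrM mulNr mulVf// powR_inv1//.
exact/ltW/grid_fine_gt0.
Qed.

Lemma haar_sqr J x : D J -> haar D J x ^+ 2 = (fine (mu J))^-1 * \1_J x.
Proof.
move=> DJ; have [_ _ _ cov] := grid_halves hD DJ.
have [Jx|nJx] := pselect (J x); last first.
  by rewrite haar_out// expr0n/= indicE memNset// mulr0.
rewrite indicE mem_set// mulr1 -haar_height_sqr//.
move: Jx; rewrite -{1}cov => -[rx|lx]; first by rewrite haar_right.
by rewrite haar_left// sqrrN.
Qed.

Lemma integrable_grid_indic J : D J -> mu.-integrable setT (EFin \o \1_J).
Proof.
move=> DJ; apply: integrable_indic_fin; first exact: (grid_measurable hD).
by rewrite ltey_eq (grid_measure_fin hD).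
Qed.

Lemma integrable_haar J : D J -> mu.-integrable setT (EFin \o haar D J).
Proof.
move=> DJ; have := integrableB measurableT
  (integrable_grid_indic (right_half_grid DJ))
  (integrable_grid_indic (left_half_grid DJ)).
by move=> /(integrableZl measurableT (c J)).
Qed.

Lemma measurable_haar J : D J -> measurable_fun setT (haar D J).
Proof.
by move=> /integrable_haar ih; apply/measurable_EFinP; case/integrableP: ih.
Qed.

Lemma Rintegral_haar J : D J -> (\int[mu]_x haar D J x)%R = 0.
Proof.
move=> DJ; have [iR iL] := (integrable_grid_indic (right_half_grid DJ),
                            integrable_grid_indic (left_half_grid DJ)).
rewrite /haar RintegralZl//; last exact: (integrableB measurableT iR iL).
rewrite RintegralB// !Rintegral_indic;
  try exact: (grid_measurable hD (left_half_grid _)).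
  by rewrite fine_right_half// fine_left_half// subrr mulr0.
exact: (grid_measurable hD (right_half_grid _)).
Qed.

Lemma inner_haar_self J : D J -> inner (haar D J) (haar D J) = 1.
Proof.
move=> DJ; rewrite /inner; under eq_Rintegral do rewrite -expr2 haar_sqr//.
rewrite RintegralZl//; last exact: integrable_grid_indic.
rewrite Rintegral_indic; last exact: (grid_measurable hD).
by rewrite mulVf// gt_eqF// grid_fine_gt0.
Qed.

Lemma L2_haar J : D J -> haar D J \in Lfun mu 2%:E.
Proof.
move=> DJ; apply/Lfun2P; split; first exact: measurable_haar.
have := integrable_grid_indic DJ.
move=> /(integrableZl measurableT (fine (mu J))^-1)/integrableP[_].
apply: le_lt_trans; apply: ge0_le_integral => //.
- by move=> x _; rewrite lee_fin sqr_ge0.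
- by apply/measurable_EFinP; apply: measurable_funX; exact: measurable_haar.
- apply/measurableT_comp => //; apply/measurable_EFinP.
  apply: measurable_funM => //; apply: measurable_indic.
  exact: (grid_measurable hD).
- by move=> x _; rewrite /= lee_fin haar_sqr// ler_norm.
Qed.

Lemma Lnorm_haar J : D J -> Lnorm mu 2%:E (EFin \o haar D J) = 1%E.
Proof.
move=> DJ; rewrite Lnorm2E.
under eq_integral do rewrite expr2.
have ih2 := integrable_mul_Lfun2 (L2_haar DJ) (L2_haar DJ).
have := inner_haar_self DJ; rewrite /inner /Rintegral => h.
rewrite -[X in poweR X _]fineK ?h ?poweR1r//.
exact: (integrable_fin_num measurableT ih2).
Qed.

(** If [K] were not contained in the half [A] that it meets, it would contain
    [A]; its measure, a power of [2] between those of [A] and [J] and different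
    from that of [J], is then that of [A], which forces [K = A]. *)
Lemma grid_sub_half K J : D K -> D J -> K `<=` J -> K <> J ->
  K `<=` right_half D J \/ K `<=` left_half D J.
Proof.
move=> DK DJ KJ neq; have [cR cL dis cov] := grid_halves hD DJ.
have [x Kx] : exists x, K x.
  apply/set0P/eqP => K0; have := grid_measure_gt0 hD DK.
  by rewrite K0 measure0 ltxx.
have key A : dyadic_children D J A -> A x -> K `<=` A.
  move=> [DA AJ mA] Ax; case: hD => _ _ /(_ _ _ DK DA)[KA|KA|KA].
  - by have : (K `&` A) x by []; rewrite KA.
  - by rewrite -KA; exact: subIsetr.
  have AK : A `<=` K by rewrite -KA; exact: subIsetl.
  have mle (B C : set R) : D B -> D C -> B `<=` C -> (mu B <= mu C)%E.
    move=> DB DC BC; apply: le_measure; rewrite ?inE//;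
      exact: (grid_measurable hD).
  have [kJ mJ] := grid_measure hD DJ; have [kK mK] := grid_measure hD DK.
  have leAK := mle _ _ DA DK AK; have leKJ := mle _ _ DK DJ KJ.
  have neqm : mu K != mu J.
    by apply/eqP => KJm; apply: neq; exact: (grid_eq hD DK DJ KJm Kx (KJ _ Kx)).
  have mAE : mu A = (2 ^ (kJ - 1))%:E.
    by rewrite mA mJ -EFinM expfzDr// mulrC.
  suff -> : K = A by [].
  apply: (grid_eq hD DK DA _ Kx Ax); rewrite mAE mK.
  move: leAK leKJ neqm; rewrite mAE mK mJ !lee_fin.
  rewrite !ler_eXz2l ?ltr1n// eqe => h1 h2 h3.
  have : kK != kJ by apply: contra h3 => /eqP->.
  by move=> h4; congr EFin; congr (_ ^ _); lia.
move: (KJ _ Kx); rewrite -{1}cov => -[Rx|Lx]; [left|right]; exact: key.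
Qed.

(** On [K] the function [haar D J] is constant, and [haar D K] has mean zero. *)
Lemma inner_haar_sub K J : D K -> D J -> K `<=` J -> K <> J ->
  inner (haar D K) (haar D J) = 0.
Proof.
move=> DK DJ KJ neq.
have [e he] : exists e, forall x, haar D K x * haar D J x = e * haar D K x.
  have [h|h] := grid_sub_half DK DJ KJ neq; [exists (c J)|exists (- c J)] => x;
    (have [Kx|nKx] := pselect (K x); last by rewrite haar_out// mul0r mulr0).
  - by rewrite (haar_right DJ (h _ Kx)) mulrC.
  - by rewrite (haar_left DJ (h _ Kx)) mulrC.
rewrite /inner; under eq_Rintegral do rewrite he.
by rewrite RintegralZl ?Rintegral_haar ?mulr0//; exact: integrable_haar.
Qed.

Lemma innerC (f g : R -> R) : inner f g = inner g f.
Proof. by rewrite /inner; under eq_Rintegral do rewrite mulrC. Qed.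

Lemma inner_haar_neq K J : D K -> D J -> K <> J ->
  inner (haar D K) (haar D J) = 0.
Proof.
move=> DK DJ neq; case: (hD) => _ _ /(_ _ _ DK DJ)[KJ|KJ|KJ].
- rewrite /inner (_ : (fun x => _) = fun=> 0) ?Rintegral_cst ?mul0r//.
  apply/funext => x; have [Kx|nKx] := pselect (K x); last first.
    by rewrite haar_out// mul0r.
  rewrite [X in _ * X]haar_out ?mulr0// => Jx.
  by have : (K `&` J) x by []; rewrite KJ.
- by apply: inner_haar_sub => //; rewrite -KJ; exact: subIsetr.
- rewrite innerC; apply: inner_haar_sub => //; last exact: nesym.
  by rewrite -KJ; exact: subIsetl.
Qed.

End haar.

(** * Convergence in L2 of a series with shrinking supports *)

Section nested.
Context (R : realType) (A : nat -> set R) (u : nat -> R -> R).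
Local Notation mu := (@lebesgue_measure R).
Hypothesis mA : forall k, measurable (A k).
Hypothesis AS : forall k, A k.+1 `<=` A k.
Hypothesis muA : forall k, (mu (A k) <= (2^-1 ^+ k)%:E)%E.
Hypothesis mu_ : forall k, measurable_fun [set: R] (u k).
Hypothesis uA : forall k x, `|u k x| <= \1_(A k) x.

Let P n x := \sum_(1 <= k < n.+1) u k x.
(** These weights dominate [k ^ 2] ([sqr_le_w]) while their ratio is small
    enough for the sum of the [w k * 2^-k] to converge; the ratio [32 / 25] is
    chosen so that [32 / 25 * 2^-1 = (4 / 5) ^ 2] is a square. *)
Let w k : R := 64 * (32 / 25) ^+ k.

Let PS n x : P n.+1 x = P n x + u n.+1 x.
Proof. by rewrite /P big_nat_recr. Qed.

Let sub_A n m : (n <= m)%N -> A m `<=` A n.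
Proof.
move=> /subnK <-; elim: (m - n)%N => // j IH x; rewrite addSn => /AS; exact: IH.
Qed.

Let u_out k x : ~ A k x -> u k x = 0.
Proof.
move=> nA; apply/eqP; rewrite -normr_le0; apply: le_trans (uA k x) _.
by rewrite indicE memNset.
Qed.

Let P_stable n m x : ~ A n x -> (n <= m)%N -> P m x = P n x.
Proof.
move=> nA /subnK <-; elim: (m - n)%N => // j IH.
rewrite addSn PS IH u_out ?addr0// => Ax; apply: nA; move: Ax.
by apply: sub_A; rewrite ltnW// ltnS leq_addl.
Qed.

Let P_dist n j x : `|P (j + n) x - P n x| <= j%:R.
Proof.
elim: j => [|j IH]; first by rewrite subrr normr0.
rewrite addSn PS addrAC -natr1; apply: le_trans (ler_normD _ _) _.
apply: lerD => //; apply: le_trans (uA _ _) _.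
by rewrite indicE; case: (_ \in _).
Qed.

Let sqr_le_w k : k%:R ^+ 2 <= w k.
Proof.
(* Bernoulli's inequality, with [(9 / 8) ^ 2 < 32 / 25]. *)
have bern : 1 + k%:R / 8 <= (9 / 8) ^+ k :> R.
  elim: k => [|k IH]; first by rewrite expr0 mul0r addr0.
  have k0 : 0 <= k%:R :> R by [].
  by rewrite exprSr -natr1; nra.
have k0 : 0 <= k%:R :> R by [].
have : k%:R ^+ 2 <= 64 * ((9 / 8) ^+ k) ^+ 2 :> R by nra.
move=> /le_trans; apply; rewrite /w -exprM mulnC exprM ler_pM2l//.
by rewrite lerXn2r ?nnegrE//; lra.
Qed.

Let w_ge0 k : 0 <= w k.
Proof. by rewrite mulr_ge0// exprn_ge0//; lra. Qed.

Let measurable_P n : measurable_fun [set: R] (P n).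
Proof.
elim: n => [|n IH].
  by rewrite (_ : P 0 = cst 0)//; apply/funext => x; rewrite /P big_geq.
rewrite (_ : P n.+1 = P n \+ u n.+1); last by apply/funext => x; rewrite PS.
exact: measurable_funD.
Qed.

(** Off the intersection of the [A k] the partial sums are eventually constant,
    and [f] is their final value; on the intersection, where they may diverge,
    [f] is set to [0].  A point at which [f] differs from [P n] lies in some
    [A m] with [n <= m] such that at most [m] terms, each bounded by [1], make
    up the difference. *)
Let limit_exists : exists f : R -> R, measurable_fun [set: R] f /\
  forall n x, f x = P n x \/
    exists m, [/\ (n <= m)%N, A m x & `|f x - P n x| <= m%:R].
Proof.
pose Z := \bigcap_n A n.
have mZ : measurable Z by exact: bigcapT_measurable.
have /choice[f fP] x : exists y,
    (Z x -> y = 0) /\ forall n, ~ A n x -> y = P n x.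
  have [Zx|/existsNP[N /not_implyP[_ nAN]]] := pselect (Z x).
    by exists 0; split=> // n nA; exfalso; apply: nA; exact: Zx.
  exists (P N x); split=> [Zx|n nA]; first by exfalso; apply: nAN; exact: Zx.
  have [Nn|nN] := leqP N n; first by rewrite (P_stable nAN Nn).
  by rewrite (P_stable nA (ltnW nN)).
exists f; split.
  apply: (@measurable_fun_cvg _ _ _ _ (fun n x => P n x * \1_(~` Z) x)).
    move=> n; apply: measurable_funM => //; apply: measurable_indic.
    exact: measurableC.
  move=> x _; have [f0 fE] := fP x; apply: cvg_near_cst.
  have [Zx|nZx] := pselect (Z x).
    by near=> n; rewrite f0// indicE memNset ?mulr0//=; apply.
  have /existsNP[N /not_implyP[_ nAN]] := nZx.
  exists N => //= n Nn; rewrite indicE mem_set// mulr1 (fE n)//.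
  by move/(sub_A Nn).
move=> n x; have [f0 fE] := fP x.
have [Ax|nAx] := pselect (A n x); last by left; exact: fE.
right; have [Zx|nZx] := pselect (Z x).
  exists n; split=> //; rewrite f0// sub0r normrN.
  by have := P_dist 0 n x; rewrite addn0 [P 0 x]/P big_geq// subr0.
have exN : exists N, `[< ~ A N x >].
  by move/existsNP: nZx => [N /not_implyP[_ nAN]]; exists N; exact/asboolP.
case: (ex_minnP exN) => -[|m] /asboolP nAm minm.
  by exfalso; apply: nAm; exact: (sub_A (leq0n n)).
have Am : A m x.
  apply: contrapT => nA.
  by have := minm m (introT (asboolP _) nA); rewrite ltnn.
have nm : (n <= m)%N.
  by rewrite leqNgt; apply/negP => mn; apply: nAm; exact: (sub_A mn).
exists m; split => //; rewrite (fE _ nAm) PS (u_out nAm) addr0 -{1}(subnK nm).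
by apply: le_trans (P_dist _ _ _) _; rewrite ler_nat leq_subr.
Unshelve. all: by end_near. Qed.

(** By [limit_exists] the square of [f - P n] is bounded by the sum over
    [k >= n] of [w k] times the indicator of [A k], whose integral is a
    geometric tail of ratio [16 / 25]. *)
Lemma nested_L2_sum : exists f : R -> R, L2_sum u f.
Proof.
have [f [mf fP]] := limit_exists; exists f.
have W0 n k x : (0 <= (w (k + n) * \1_(A (k + n)) x)%:E)%E.
  by rewrite lee_fin mulr_ge0.
have ptw n x : (((f x - P n x) ^+ 2)%:E <=
    \sum_(0 <= k <oo) (w (k + n) * \1_(A (k + n)) x)%:E)%E.
  have [->|[m [nm Am fm]]] := fP n x.
    by rewrite subrr expr0n; apply: nneseries_ge0.
  apply: (@le_trans _ _ (w m)%:E).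
    rewrite lee_fin (le_trans _ (sqr_le_w m))// -real_normK ?num_real//.
    by rewrite lerXn2r ?nnegrE.
  have := @nneseries_lim_ge _ (fun k => (w (k + n) * \1_(A (k + n)) x)%:E)
     xpredT 0 (m - n).+1 (fun _ _ _ => W0 _ _ _).
  apply: le_trans; rewrite big_nat_recr//= subnK// indicE mem_set// mulr1.
  by rewrite leeDr// sume_ge0.
have bound n : (\int[mu]_x ((f x - P n x) ^+ 2)%:E <=
    ((40 / 3 * (4 / 5) ^+ n) ^+ 2)%:E)%E.
  have mW k : measurable_fun [set: R]
      (fun x => (w (k + n) * \1_(A (k + n)) x)%:E).
    by apply/measurable_EFinP; apply: measurable_funM.
  apply: (@le_trans _ _ (\int[mu]_x
     \sum_(0 <= k <oo) (w (k + n) * \1_(A (k + n)) x)%:E)%E).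
    apply: ge0_le_integral => //.
    - by move=> x _; rewrite lee_fin sqr_ge0.
    - apply/measurable_EFinP; apply: measurable_funX.
      exact: (measurable_funB mf (measurable_P n)).
    - apply: (@ge0_emeasurable_sum _ _ _ _ _ xpredT) => [k x _ _|k _];
        [exact: W0|exact: mW].
  rewrite integral_nneseries//.
  apply: lime_le.
    by apply: is_cvg_nneseries => k _ _; exact: integral_ge0.
  apply: nearW => K.
  have [C0 q0] : 0 <= 64%:R :> R /\ 0 <= 16 / 25 :> R by split=> //; lra.
  apply: (@le_trans _ _ (\sum_(0 <= k < K) (64 * (16 / 25) ^+ (k + n))%:E)%E).
    apply: lee_sum => k _.
    rewrite integral_scale_indic; [|exact: w_ge0|exact: mA].
    apply: (@le_trans _ _ ((w (k + n))%:E * (2^-1 ^+ (k + n))%:E)%E).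
      by apply: lee_pmul => //; [exact: w_ge0|exact: muA].
    rewrite -EFinM lee_fin /w -mulrA -exprMn le_eqVlt; apply/orP; left.
    by apply/eqP; congr (_ * _ ^+ _); lra.
  rewrite sumEFin lee_fin.
  have -> : \sum_(0 <= k < K) 64 * (16 / 25) ^+ (k + n) =
     64 * (16 / 25) ^+ n * (25 / 9 * (1 - (16 / 25) ^+ K)) :> R.
    elim: K => [|K IH]; first by rewrite big_geq// expr0 subrr !mulr0.
    rewrite big_nat_recr//= IH exprD exprS.
    by set a := _ ^+ n; set b := _ ^+ K; field.
  rewrite [leRHS]exprMn -[_ ^+ n ^+ 2]exprM mulnC exprM.
  rewrite (_ : (4 / 5) ^+ 2 = 16 / 25 :> R); last by field.
  have : 0 <= (16 / 25) ^+ n :> R by rewrite exprn_ge0.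
  have : 0 <= (16 / 25) ^+ K :> R by rewrite exprn_ge0.
  set a := _ ^+ n; set b := _ ^+ K; nra.
split.
  apply/Lfun2P; split=> //.
  have := bound 0%N; rewrite (_ : (fun x => _) = (fun x => (f x ^+ 2)%:E)).
    by move=> /le_lt_trans; apply; exact: ltry.
  by apply/funext => x; rewrite /P big_geq// subr0.
apply: (@squeeze_cvge _ _ _ _ (fun=> 0%E) _
  (fun n => (40 / 3 * (4 / 5) ^+ n)%:E) _ 0%E).
- apply: nearW => n; rewrite Lnorm_ge0/=.
  rewrite -[leLHS]/(Lnorm mu 2%:E (EFin \o (fun x => f x - P n x))) Lnorm2E.
  rewrite [leRHS](_ : _ = (((40 / 3 * (4 / 5) ^+ n) ^+ 2)%:E `^ 2^-1)%E).
    apply: gt0_ler_poweR; rewrite ?in_itv/= ?leey ?andbT//.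
    by apply: integral_ge0 => x _; rewrite lee_fin sqr_ge0.
  have y0 : 0 <= 40 / 3 * (4 / 5) ^+ n :> R.
    by rewrite mulr_ge0// ?exprn_ge0//; lra.
  set y := 40 / 3 * _ in y0 *.
  by rewrite poweR_EFin -powR_mulrn// -powRrM mulfV// powRr1.
- exact: cvg_cst.
- apply: cvg_EFin; first exact: nearW.
  apply: (@cvg_geometric R (40 / 3) (4 / 5)).
  by rewrite ger0_norm; lra.
Qed.

End nested.

(** * Passing to the limit in L2 *)

Section L2_limits.
Context (R : realType).
Local Notation mu := (@lebesgue_measure R).
Implicit Types (f h : R -> R) (u : nat -> R -> R).

Lemma innerDl f f' h : f \in Lfun mu 2%:E -> f' \in Lfun mu 2%:E ->
  h \in Lfun mu 2%:E -> inner (fun x => f x + f' x) h = inner f h + inner f' h.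
Proof.
move=> l2f l2f' l2h; rewrite /inner -RintegralD//.
- by under eq_Rintegral do rewrite mulrDl.
- exact: (integrable_mul_Lfun2 l2f l2h).
- exact: (integrable_mul_Lfun2 l2f' l2h).
Qed.

Lemma innerZl c f h : f \in Lfun mu 2%:E -> h \in Lfun mu 2%:E ->
  inner (fun x => c * f x) h = c * inner f h.
Proof.
move=> l2f l2h; rewrite /inner -RintegralZl//.
  by under eq_Rintegral do rewrite -mulrA.
exact: (integrable_mul_Lfun2 l2f l2h).
Qed.

Lemma inner_partial_sum u n h : (forall k, u k \in Lfun mu 2%:E) ->
  h \in Lfun mu 2%:E ->
  inner (fun x => \sum_(1 <= k < n.+1) u k x) h =
  \sum_(1 <= k < n.+1) inner (u k) h.
Proof.
move=> l2u l2h; elim: n => [|n IH].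
  rewrite big_geq// /inner (_ : (fun x => _) = fun=> 0) ?Rintegral_cst ?mul0r//.
  by apply/funext => x; rewrite big_geq// mul0r.
rewrite [RHS]big_nat_recr//= -IH -innerDl//; last exact: Lfun2_sum.
by congr inner; apply/funext => x; rewrite big_nat_recr.
Qed.

(** Inner products are continuous by [normr_inner_le], and those of the partial
    sums of an orthogonal series with a member of the family are eventually
    constant. *)
Lemma inner_L2_sum u f h d N : (forall k, u k \in Lfun mu 2%:E) ->
  L2_sum u f -> h \in Lfun mu 2%:E -> Lnorm mu 2%:E (EFin \o h) = 1%E ->
  (forall n, (N <= n)%N -> inner (fun x => \sum_(1 <= k < n.+1) u k x) h = d) ->
  inner f h = d.
Proof.
move=> l2u [l2f cvgf] l2h h1 hd.
suff : (`|inner f h - d|%:E <= 0)%E.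
  by rewrite lee_fin normr_le0 subr_eq0 => /eqP.
apply: cvge_ge cvgf; exists N => // n /= Nn.
have l2P := Lfun2_sum n l2u.
have -> : inner f h - d =
    inner (fun x => f x - \sum_(1 <= k < n.+1) u k x) h.
  rewrite -(hd n Nn) -mulN1r -(innerZl _ l2P l2h).
  rewrite -(innerDl l2f (Lfun2Z (-1) l2P) l2h).
  by congr inner; apply/funext => x; rewrite mulN1r.
by have := normr_inner_le (Lfun2B l2f l2P) l2h; rewrite h1 mule1.
Qed.

(** The norm of [(f - s) * \1_A] is at most that of the difference between [f]
    and any far enough partial sum, hence zero. *)
Lemma ae_L2_sum u f (A : set R) s N : (forall k, u k \in Lfun mu 2%:E) ->
  L2_sum u f -> measurable A ->
  (forall n x, (N <= n)%N -> A x -> \sum_(1 <= k < n.+1) u k x = s) ->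
  {ae mu, forall x : measurableTypeR R, A x -> f x = s}.
Proof.
move=> l2u [l2f cvgf] mA hs.
have /Lfun2P[mf _] := l2f.
pose g x := (f x - s) * \1_A x.
have mg : measurable_fun [set: measurableTypeR R] g.
  by apply: measurable_funM; [exact: measurable_funB|exact: measurable_indic].
have g0 : Lnorm mu 2%:E (EFin \o g) = 0%E.
  apply/eqP; rewrite eq_le Lnorm_ge0 andbT.
  apply: cvge_ge cvgf; exists N => // n /= Nn.
  rewrite -[leRHS]/(Lnorm mu 2%:E
    (EFin \o (fun x => f x - \sum_(1 <= k < n.+1) u k x))).
  have /Lfun2P[mP _] := Lfun2_sum n l2u.
  rewrite !Lnorm2E; apply: gt0_ler_poweR; rewrite ?in_itv/= ?leey ?andbT//.
  - by apply: integral_ge0 => x _; rewrite lee_fin sqr_ge0.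
  - by apply: integral_ge0 => x _; rewrite lee_fin sqr_ge0.
  apply: ge0_le_integral => //.
  - by move=> x _; rewrite lee_fin sqr_ge0.
  - by apply/measurable_EFinP; exact: measurable_funX.
  - by apply/measurable_EFinP; apply: measurable_funX; exact: measurable_funB.
  move=> x _; rewrite lee_fin /g indicE.
  have [Ax|nAx] := pselect (A x); last first.
    by rewrite memNset// mulr0 expr0n sqr_ge0.
  by rewrite mem_set// mulr1 (hs n).
apply: filterS (Lnorm2_eq0 mg g0) => x gx Ax.
have := gx; rewrite /g indicE mem_set// mulr1 => /eqP.
by rewrite subr_eq0 => /eqP.
Qed.

End L2_limits.

(** * Sums over the grid that charge a single sequence *)

Section esum_seq.
Context (R : realType) (T : choiceType) (D : set T).
Context (e : nat -> T) (g : T -> \bar R).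
Hypothesis De : forall k, D (e k).
Hypothesis e_inj : injective e.
Hypothesis g_ge0 : forall t, (0 <= g t)%E.

Let esum_range : \esum_(t in D `&` range e) g t = (\sum_(k <oo) g (e k))%E.
Proof.
rewrite setIidr; last by move=> _ [k _ <-].
by rewrite esum_image ?nneseries_esumT// => i j _ _; exact: e_inj.
Qed.

Lemma le_esum_seq n : (\sum_(0 <= k < n) g (e k) <= \esum_(t in D) g t)%E.
Proof.
apply: (@le_trans _ _ (\sum_(k <oo) g (e k))%E).
  by apply: nneseries_lim_ge => k _ _.
rewrite -esum_range esum_mkcondr; apply: le_esum => t _.
by case: ifPn.
Qed.

Lemma esum_seq_le M : (forall t, D t -> ~ range e t -> g t = 0%E) ->
  (forall n, \sum_(0 <= k < n) g (e k) <= M)%E -> (\esum_(t in D) g t <= M)%E.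
Proof.
move=> g0 leM; rewrite (_ : \esum_(t in D) g t = (\sum_(k <oo) g (e k))%E).
  by apply: lime_le; [exact: is_cvg_nneseries|exact: nearW].
rewrite -esum_range esum_mkcondr; apply: eq_esum => t Dt.
by case: ifPn => // /negP; rewrite inE => /(g0 _ Dt).
Qed.

End esum_seq.

(** * Haar series along a chain of right halves *)

Section chain.
Context (R : realType) (D : set (set R)) (I : nat -> set R).
Local Notation mu := (@lebesgue_measure R).
Hypothesis hD : dyadic_grid D.
Hypothesis DI0 : D (I 0).
Hypothesis lenI0 : fine (mu (I 0)) = 1.
Hypothesis hI : forall k, I k.+1 = right_half D (I k).

Lemma chain_grid k : D (I k).
Proof. by elim: k => // k IH; rewrite hI; exact: right_half_grid. Qed.

Lemma chain_len k : fine (mu (I k)) = 2^-1 ^+ k.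
Proof.
elim: k => // k IH; rewrite hI (fine_right_half hD) ?IH ?exprS//.
exact: chain_grid.
Qed.

Lemma chain_measure k : mu (I k) = (2^-1 ^+ k)%:E.
Proof. by rewrite -chain_len fineK// (grid_measure_fin hD (chain_grid k)). Qed.

Lemma chain_inj : injective I.
Proof.
move=> i j Iij; have := chain_len i; rewrite Iij chain_len.
move/(ieexprIn _ _); rewrite invr_gt0 invr_eq1 ltr0n pnatr_eq1.
by move=> /(_ isT isT) ->.
Qed.

Lemma chain_subS k : I k.+1 `<=` I k.
Proof. by rewrite hI; apply: (right_half_sub hD); exact: chain_grid. Qed.

Lemma chain_sub n m : (n <= m)%N -> I m `<=` I n.
Proof.
move=> /subnK <-; elim: (m - n)%N => // j IH x.
by rewrite addSn => /chain_subS; exact: IH.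
Qed.

Lemma chain_measurable k : measurable (I k).
Proof. exact: (grid_measurable hD (chain_grid k)). Qed.

Lemma chain_cap_null : mu (\bigcap_k I k) = 0%E.
Proof.
apply/eqP; rewrite eq_le measure_ge0 andbT.
have cvg0 : (fun n => (1 * 2^-1 ^+ n)%:E) @ \oo --> (0%:E : \bar R).
  apply: cvg_EFin; first exact: nearW.
  apply: (@cvg_geometric R 1 2^-1).
  by rewrite ger0_norm ?invr_ge0// invf_lt1// ltr1n.
apply: (cvge_ge _ cvg0); apply: nearW => n /=; rewrite mul1r.
rewrite -chain_measure; apply: le_measure; rewrite ?inE.
- by apply: bigcapT_measurable => k; exact: chain_measurable.
- exact: chain_measurable.
- by move=> x; apply.
Qed.

Variable b : nat -> R.
Let u k x := b k * haar D (I k) x.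
Let c k := fine (mu (I k)) `^ (- 2^-1).
(** The value of the [k]-th term on the right half of [I k]. *)
Let a k := b k * c k.
Let S k := \sum_(1 <= j < k) a j.

Let c2 k : c k ^+ 2 = (fine (mu (I k)))^-1.
Proof. by rewrite (haar_height_sqr hD)//; exact: chain_grid. Qed.

Let c_ge0 k : 0 <= c k. Proof. exact: powR_ge0. Qed.

Let L2u k : u k \in Lfun mu 2%:E.
Proof. by apply: Lfun2Z; apply: (L2_haar hD); exact: chain_grid. Qed.

Let u_right k x : I k.+1 x -> u k x = a k.
Proof. by rewrite hI => ?; rewrite /u (haar_right hD)//; exact: chain_grid. Qed.

Let u_left k x : left_half D (I k) x -> u k x = - a k.
Proof. by move=> ?; rewrite /u (haar_left hD) ?mulrN//; exact: chain_grid. Qed.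

Let u_out k x : ~ I k x -> u k x = 0.
Proof. by move=> ?; rewrite /u (haar_out hD) ?mulr0//; exact: chain_grid. Qed.

Let I_cases k x : I k x -> I k.+1 x \/ left_half D (I k) x.
Proof.
have [_ _ _ cov] := grid_halves hD (chain_grid k).
by rewrite -{1}cov hI.
Qed.

Let left_out k x : left_half D (I k) x -> ~ I k.+1 x.
Proof.
have [_ _ dis _] := grid_halves hD (chain_grid k).
move=> lx; rewrite hI => rx.
by have : (right_half D (I k) `&` left_half D (I k)) x by []; rewrite dis.
Qed.

Lemma chain_L2_sum : (forall k, `|a k| <= 1) -> exists f, L2_sum u f.
Proof.
move=> a1; apply: (@nested_L2_sum _ I).
- exact: chain_measurable.
- exact: chain_subS.
- by move=> k; rewrite chain_measure.
- by move=> k; have /Lfun2P[] := L2u k.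
move=> k x; have [Ix|nIx] := pselect (I k x); last first.
  by rewrite u_out// normr0 indicE.
rewrite indicE mem_set//.
by have [/u_right->|/u_left->] := I_cases Ix; rewrite ?normrN.
Qed.

Section with_sum.
Variable f : R -> R.
Hypothesis sumf : L2_sum u f.

Let l2f : f \in Lfun mu 2%:E := sumf.1.

Lemma inner_chain_coef k : inner f (haar D (I k.+1)) = b k.+1.
Proof.
have Dk := chain_grid k.+1; have L2k := L2_haar hD Dk.
apply: (@inner_L2_sum _ u _ _ _ k.+1) => // [|n kn]; first exact: Lnorm_haar.
rewrite inner_partial_sum// (bigD1_seq k.+1) ?mem_index_iota ?iota_uniq//=.
rewrite innerZl// (inner_haar_self hD)// mulr1 big1 ?addr0// => j jk.
rewrite innerZl ?(inner_haar_neq hD) ?mulr0//.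
- exact: chain_grid.
- by move/chain_inj => jkE; rewrite jkE eqxx in jk.
- by apply: (L2_haar hD); exact: chain_grid.
Qed.

Lemma inner_chain_out J : D J -> ~ range (fun k => I k.+1) J ->
  inner f (haar D J) = 0.
Proof.
move=> DJ nJ; have L2J := L2_haar hD DJ.
apply: (@inner_L2_sum _ u _ _ _ 0) => // [|n _]; first exact: Lnorm_haar.
rewrite inner_partial_sum// big_nat_cond big1// => -[|k]//.
rewrite andbT => /andP[_ _].
rewrite innerZl ?(inner_haar_neq hD) ?mulr0//.
- exact: chain_grid.
- by move=> IJ; apply: nJ; exists k.
- by apply: (L2_haar hD); exact: chain_grid.
Qed.

(** The weight [|I k|^-1] is the square of the height of [haar D (I k)], so the
    sum defining [Hhalf] is the sum of the squares of the [a k]. *)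
Lemma chain_Hhalf M :
  (forall n, \sum_(0 <= k < n) a k.+1 ^+ 2 <= M) -> Hhalf D f.
Proof.
move=> leM; split; first exact: sumf.1.
apply: (@le_lt_trans _ _ M%:E); last exact: ltry.
apply: (@esum_seq_le _ _ _ (fun k => I k.+1)).
- by move=> k; exact: chain_grid.
- by move=> i j /chain_inj[].
- move=> J; rewrite lee_fin mulr_ge0 ?exprn_ge0// invr_ge0 fine_ge0//.
- by move=> J DJ nJ; rewrite inner_chain_out// normr0 expr0n mulr0.
move=> n; rewrite sumEFin lee_fin; apply: le_trans (leM n).
apply: ler_sum => k _; rewrite inner_chain_coef real_normK ?num_real//.
by rewrite /a exprMn c2 mulrC.
Qed.

(** On the left half of [I m] the terms before the [m]-th take their right-half
    value, the [m]-th its left-half value, and the later ones vanish. *)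
Let P_value m n x : (0 < m <= n)%N -> left_half D (I m) x ->
  \sum_(1 <= k < n.+1) u k x = S m - a m.
Proof.
move=> /andP[m0 mn] lx; have Imx := left_half_sub hD (chain_grid m) lx.
rewrite (@big_cat_nat _ _ _ m)//=; last exact: (leq_trans mn).
rewrite [X in _ + X]big_ltn ?ltnS// u_left//.
rewrite [X in - _ + X]big_nat [X in - _ + X]big1 ?addr0.
  congr (_ + _); apply: eq_big_nat => k /andP[_ km].
  by rewrite u_right//; exact: (chain_sub km).
move=> k /andP[mk _]; apply: u_out => Ikx.
by apply: (left_out lx); exact: (chain_sub mk).
Qed.

Lemma ae_left_value m : (0 < m)%N ->
  {ae mu, forall x : measurableTypeR R, left_half D (I m) x -> f x = S m - a m}.
Proof.
move=> m0; apply: (@ae_L2_sum _ u f _ _ m) => //.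
  by apply: (grid_measurable hD); apply: (left_half_grid hD); exact: chain_grid.
by move=> n x mn; apply: P_value; rewrite m0.
Qed.

Hypothesis a_ge0 : forall k, 0 <= a k.+1.
Hypothesis a_mono : forall k m, (k <= m)%N -> a m.+1 <= a k.+1.

(** A point of [I k.+2] outside the intersection of the chain lies in the left
    half of some [I m.+1] with [k < m], where [f] is [S m.+1 - a m.+1]; since
    [a m.+1 <= a k.+1] and [a k.+1] is one of the terms of [S m.+1] that are not
    in [S k.+1], this is at least [S k.+1]. *)
Lemma ae_right_lower k :
  {ae mu, forall x : measurableTypeR R, I k.+2 x -> S k.+1 <= f x}.
Proof.
have aeZ : {ae mu, forall x : measurableTypeR R, ~ (\bigcap_k I k) x}.
  exists (\bigcap_k I k); split; last by move=> x /= /contrapT.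
    by apply: bigcapT_measurable => j; exact: chain_measurable.
  exact: chain_cap_null.
have aeV := ae_foralln (fun m => ae_left_value (ltn0Sn m)).
apply: (filterS2 _ _ aeZ aeV) => x nZ fx Ix.
have exN : exists N, `[< ~ I N x >].
  by move/existsNP: nZ => [N /not_implyP[_ nI]]; exists N; exact/asboolP.
case: (ex_minnP exN) => -[|[|m]] /asboolP nIm minm.
- by exfalso; apply: nIm; exact: (chain_sub (leq0n k.+2)).
- by exfalso; apply: nIm; exact: (@chain_sub 1 k.+2).
have Im : I m.+1 x.
  apply: contrapT => nI.
  by have := minm m.+1 (introT (asboolP _) nI); rewrite ltnn.
have km : (k < m)%N.
  rewrite ltnNge; apply/negP => mk; apply: nIm.
  exact: (@chain_sub m.+2 k.+2).
have [//|lx] := I_cases Im; rewrite (fx m lx).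
rewrite /S (@big_cat_nat _ _ _ k.+1 1 m.+1)//=; last exact: leqW.
rewrite -addrA lerDl subr_ge0 big_ltn//.
apply: le_trans (a_mono (ltnW km)) _; rewrite lerDl big_nat sumr_ge0//.
by case=> // j _; exact: a_ge0.
Qed.

Lemma inner_sqr_lower k :
  c k.+1 * (fine (mu (I k.+1)) / 2 * (S k.+1 ^+ 2 - (S k.+1 - a k.+1) ^+ 2)) <=
  inner (fun x => f x ^+ 2) (haar D (I k.+1)).
Proof.
have Dk := chain_grid k.+1; have isqr := Lfun2_integrable_sqr l2f.
have mR : measurable (right_half D (I k.+1) : set (measurableTypeR R)).
  exact: (grid_measurable hD (right_half_grid hD Dk)).
have mL : measurable (left_half D (I k.+1) : set (measurableTypeR R)).
  exact: (grid_measurable hD (left_half_grid hD Dk)).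
have iR := integrable_on mR isqr; have iL := integrable_on mL isqr.
have -> : inner (fun x => f x ^+ 2) (haar D (I k.+1)) =
    c k.+1 * ((\int[mu]_(x in right_half D (I k.+1)) (f x ^+ 2))%R -
              (\int[mu]_(x in left_half D (I k.+1)) (f x ^+ 2))%R).
  exact: Rintegral_indicB.
apply: ler_wpM2l => //; rewrite mulrBr; apply: lerB.
- rewrite -lee_fin /Rintegral fineK; last exact: integrable_fin_num.
  apply: (@le_trans _ _
      (\int[mu]_(x in right_half D (I k.+1)) (S k.+1 ^+ 2)%:E)%E).
    rewrite integral_cst// -[X in (_ <= _ * X)%E]fineK; last first.
      by apply: (grid_measure_fin hD); exact: right_half_grid.
    by rewrite (fine_right_half hD Dk) -EFinM lee_fin; lra.
  apply: ae_ge0_le_integral => //.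
  - by move=> x _; rewrite lee_fin sqr_ge0.
  - by move=> x _; rewrite lee_fin sqr_ge0.
  - by case/integrableP: iR.
  have := ae_right_lower k; apply: filterS => x h Rx.
  rewrite lee_fin lerXn2r ?nnegrE//; rewrite -?hI in Rx.
  - by rewrite /S big_nat sumr_ge0// => -[|j]// _; exact: a_ge0.
  - apply: le_trans (h Rx).
    by rewrite /S big_nat sumr_ge0// => -[|j]// _; exact: a_ge0.
  - exact: h.
- rewrite -lee_fin /Rintegral fineK; last exact: integrable_fin_num.
  rewrite (@ae_eq_integral _ _ _ _ _ (cst ((S k.+1 - a k.+1) ^+ 2)%:E))//.
  + rewrite integral_cst// -[X in (_ * X <= _)%E]fineK; last first.
      by apply: (grid_measure_fin hD); exact: left_half_grid.
    by rewrite (fine_left_half hD Dk) -EFinM lee_fin; lra.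
  + by case/integrableP: iL.
  + have := ae_left_value (ltn0Sn k); apply: filterS => x h Lx.
    by rewrite h.
Qed.

(** For [k >= 1] the jump of [f ^ 2] bounded below in [inner_sqr_lower] is at
    least [k * a k.+1 ^ 2], because [S k.+1] has [k] terms, all at least
    [a k.+1]; the height of the Haar function and the measure of [I k.+1], which
    are factors of that bound, cancel against the weight in [Hhalf]. *)
Lemma chain_sqr_Hhalf : Hhalf D (fun x => f x ^+ 2) ->
  exists M, forall n, \sum_(0 <= k < n) (k%:R * a k.+1 ^+ 2) ^+ 2 <= M.
Proof.
case=> _; set E := (\esum_(J in D) _)%E => Eoo.
have g0 J : (0 <= ((fine (mu J))^-1 *
    `|inner (fun x => f x ^+ 2) (haar D J)| ^+ 2)%:E)%E.
  by rewrite lee_fin mulr_ge0 ?exprn_ge0// invr_ge0 fine_ge0.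
have E0 : (0 <= E)%E by apply: esum_ge0 => J _; exact: g0.
have Dk k : D (I k.+1) by exact: chain_grid.
have inj : injective (fun k => I k.+1) by move=> i j /chain_inj[].
exists (4 * fine E) => n.
rewrite -ler_pdivrMl// mulr_sumr -lee_fin fineK ?ge0_fin_numE//.
rewrite -sumEFin; apply: le_trans (le_esum_seq Dk inj g0 n).
apply: lee_sum => -[|k] _; first by rewrite mul0r expr0n mulr0; exact: g0.
rewrite lee_fin -c2 real_normK ?num_real// -exprMn.
have SE : k.+1%:R * a k.+2 <= S k.+2.
  rewrite /S; apply: (@le_trans _ _ (\sum_(1 <= j < k.+2) a k.+2)).
    by rewrite sumr_const_nat subn1 /= mulr_natl.
  apply: ler_sum_nat => -[|j] /andP[j0 jk]; first by rewrite ltnn in j0.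
  by apply: a_mono; rewrite -ltnS ltnW.
have := inner_sqr_lower k.+1.
have a0 := a_ge0 k.+1; have cc := c2 k.+2.
have len0 := grid_fine_gt0 hD (chain_grid k.+2).
set i := inner _ _; set l := fine _ in cc len0 *; set s := S _ in SE *.
set A := a _ in a0 SE *; set C := c _ in cc *; set t : R := k.+1%:R in SE *.
move=> li.
have t1 : 1 <= t by rewrite ler1n.
have step : C * l / 2 * (t * A ^+ 2) <= i.
  apply: le_trans li; rewrite -!mulrA; apply: ler_wpM2l; first exact: c_ge0.
  apply: ler_wpM2l; first exact: ltW.
  apply: ler_wpM2l; first by rewrite invr_ge0.
  nra.
(* multiply [step] by the height [C] and use [C ^ 2 * l = 1] *)
have Ci : t * A ^+ 2 / 2 <= C * i.
  have := ler_wpM2l (c_ge0 k.+2) step; rewrite -/C; apply: le_trans.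
  rewrite le_eqVlt; apply/orP; left; apply/eqP.
  have -> : C * (C * l / 2 * (t * A ^+ 2)) = C ^+ 2 * l * (t * A ^+ 2 / 2).
    by ring.
  by rewrite cc mulVf ?gt_eqF// mul1r.
have tA0 : 0 <= t * A ^+ 2 by rewrite mulr_ge0 ?sqr_ge0// (le_trans _ t1).
rewrite (_ : 4^-1 * (t * A ^+ 2) ^+ 2 = (t * A ^+ 2 / 2) ^+ 2); last by field.
by rewrite lerXn2r ?nnegrE//; [lra|apply: le_trans Ci; lra].
Qed.

End with_sum.
End chain.

(** * The two numerical series *)

Section power_series.
Context (R : realType).
Implicit Types alpha : R.

(** Condensation: comparing the terms of index [2 * k] and [2 * k + 1] with the
    one of index [k] shows that the partial sums satisfy
    [T (2 * n + 1) <= 1 + 2^(1 - alpha) * T n], with [2^(1 - alpha) < 1]. *)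
Lemma powR_series_bounded alpha : 1 < alpha ->
  exists M, forall n, \sum_(0 <= k < n) (k.+1%:R `^ alpha)^-1 <= M.
Proof.
move=> a1; pose t k : R := (k.+1%:R `^ alpha)^-1.
pose T n := \sum_(0 <= k < n) t k.
pose r : R := (2 `^ alpha)^-1.
have a0 : 0 <= alpha by lra.
have t0 k : 0 <= t k by rewrite invr_ge0 powR_ge0.
have r2 : 2 * r < 1.
  rewrite /r ltr_pdivrMr ?powR_gt0// mul1r.
  rewrite -(@mulr_powRB1 _ 2 alpha)//; last lra.
  have : 1 `^ (alpha - 1) < 2 `^ (alpha - 1).
    by apply: gt0_ltr_powR; rewrite ?nnegrE// ?ltr1n//; lra.
  by rewrite powR1 ltr_pMr.
have todd k : t k.*2.+1 = r * t k.
  rewrite /t /r -invfM -powRM// -natrM.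
  by congr ((_%:R `^ _)^-1); rewrite -mul2n; lia.
have teven k : t k.*2.+2 <= r * t k.
  rewrite -todd /t lef_pV2 ?posrE ?powR_gt0//.
  by rewrite ge0_ler_powR// ?nnegrE// ler_nat.
have TS n : T n.+1 = T n + t n by rewrite /T big_nat_recr.
have cond n : T n.*2.+1 <= 1 + 2 * r * T n.
  elim: n => [|n IH].
    by rewrite /T big_nat1 big_geq// mulr0 addr0 /t powR1 invr1.
  rewrite doubleS !TS todd -TS.
  by have := teven n; lra.
exists (1 - 2 * r)^-1 => n.
have Tn : T n <= T n.*2.+1.
  rewrite /T (@big_cat_nat _ _ _ n 0 n.*2.+1)//=; last by rewrite -addnn; lia.
  by rewrite lerDl sumr_ge0.
rewrite -/(T n) -[leRHS]mul1r ler_pdivlMr; last lra.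
by have := cond n; lra.
Qed.

(** As [2 * alpha <= 3], the term of index [k >= 1] is at least
    [k ^ 2 / (k + 1) ^ 3 >= (k + 1)^-1 / 4]. *)
Lemma powR_series_unbounded alpha : 0 < alpha -> alpha <= 3 / 2 ->
  ~ exists M, forall n,
    \sum_(0 <= k < n) (k%:R * (k.+1%:R `^ alpha)^-1) ^+ 2 <= M :> R.
Proof.
move=> a0 a32 [M hM]; apply: (@dvg_harmonic R).
apply: nondecreasing_is_cvgn.
  by apply/nondecreasing_series => k _ _; rewrite invr_ge0.
exists (1 + 4 * M) => _ [n _ <-].
have key k : harmonic k <=
    (k == 0%N)%:R + 4 * (k%:R * (k.+1%:R `^ alpha)^-1) ^+ 2 :> R.
  case: k => [|k]; first by rewrite /= mul0r expr0n mulr0 addr0 invr1.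
  rewrite /= add0r exprMn exprVn -[_ `^ _ ^+ 2]powR_mulrn ?powR_ge0// -powRrM.
  have p3 : k.+2%:R `^ (alpha * 2) <= k.+2%:R ^+ 3 :> R.
    rewrite -powR_mulrn// ler_powR ?ler1n//; lra.
  set p := _ `^ _ in p3 *.
  have p0 : 0 < p by rewrite powR_gt0.
  have : (k.+2%:R ^+ 3)^-1 <= p^-1 by rewrite lef_pV2 ?posrE ?exprn_gt0.
  have k0 : (0 : R) <= k%:R by [].
  have -> : k.+2%:R = k%:R + 1 + 1 :> R by rewrite !natr1.
  have -> : k.+1%:R = k%:R + 1 :> R by rewrite natr1.
  set x : R := k%:R in k0 * => h.
  apply: (@le_trans _ _ (4 * ((x + 1) ^+ 2 * ((x + 1 + 1) ^+ 3)^-1))).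
    set y := x + 1 + 1; have y0 : 0 < y by rewrite /y; lra.
    rewrite mulrA ler_pdivlMr ?exprn_gt0// exprS mulrA mulVf ?gt_eqF// mul1r.
    by rewrite /y; nra.
  by apply: ler_wpM2l => //; apply: ler_wpM2l => //; exact: sqr_ge0.
rewrite /series; apply: (@le_trans _ _ (\sum_(0 <= k < n)
    ((k == 0%N)%:R + 4 * (k%:R * (k.+1%:R `^ alpha)^-1) ^+ 2))).
  exact: ler_sum.
rewrite big_split/= -mulr_sumr; apply: lerD; last by rewrite ler_pM2l.
case: n => [|n]; first by rewrite big_geq.
by rewrite big_nat_recl//= big1 ?addr0.
Qed.

End power_series.

(** * Failure of closure under products *)

Theorem proposition11 (R : realType) (D : set (set R)) (I : nat -> set R)
    (hD : dyadic_grid D)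
    (hI0 : D (I 0%N))
    (hI0l : `](-1), 0[ `<=` I 0%N)
    (hI0r : I 0%N `<=` `[(-1), 0])
    (hI : forall k : nat, I k.+1 = right_half D (I k)) :
  ~ (forall f g : R -> R, Hhalf D f -> Hhalf D g ->
       Hhalf D (fun x => f x * g x)) /\
  forall alpha : R, 1 < alpha -> alpha <= 3 / 2 ->
    let u := fun (k : nat) (x : R) =>
      (2 `^ (k%:R / 2) * k%:R `^ (alpha / 2))^-1 * haar D (I k) x in
    (exists f : R -> R, L2_sum u f) /\
    (forall f : R -> R, L2_sum u f ->
       Hhalf D f /\ ~ Hhalf D (fun x => f x ^+ 2)).
Proof.
have lenI0 : fine (@lebesgue_measure R (I 0%N)) = 1.
  have mI0 := grid_measurable hD hI0.
  have le1 : (@lebesgue_measure R (I 0%N) <= 1%:E)%E.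
    have -> : 1%:E = @lebesgue_measure R `[(-1), 0].
      by rewrite lebesgue_measure_itv/= lte_fin ltrN10 -EFinB sub0r opprK.
    by apply: le_measure; rewrite ?inE.
  have ge1 : (1%:E <= @lebesgue_measure R (I 0%N))%E.
    have -> : 1%:E = @lebesgue_measure R `](-1), 0[.
      by rewrite lebesgue_measure_itv/= lte_fin ltrN10 -EFinB sub0r opprK.
    by apply: le_measure; rewrite ?inE.
  have -> : @lebesgue_measure R (I 0%N) = 1%:E; last by [].
  by apply/eqP; rewrite eq_le le1 ge1.
suff main (alpha : R) : 1 < alpha -> alpha <= 3 / 2 ->
    let u := fun (k : nat) (x : R) =>
      (2 `^ (k%:R / 2) * k%:R `^ (alpha / 2))^-1 * haar D (I k) x in
    (exists f : R -> R, L2_sum u f) /\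
    (forall f : R -> R, L2_sum u f ->
       Hhalf D f /\ ~ Hhalf D (fun x => f x ^+ 2)).
  split=> // alg.
  have [|//|[f sumf] hf] := main (3 / 2); first lra.
  have [Hf nHf2] := hf f sumf; apply: nHf2.
  by under eq_fun do rewrite expr2; exact: alg.
move=> a1 a32 u.
pose b k : R := (2 `^ (k%:R / 2) * k%:R `^ (alpha / 2))^-1.
have aE k : b k * fine (@lebesgue_measure R (I k)) `^ (- 2^-1) =
    (k%:R `^ (alpha / 2))^-1.
  rewrite (chain_len hD hI0 lenI0 hI) /b invfM mulrAC.
  have -> : (2^-1 ^+ k) `^ (- 2^-1) = 2 `^ (k%:R / 2) :> R.
    rewrite -powR_mulrn ?invr_ge0// -powR_inv1// -!powRrM.
    by congr (_ `^ _); lra.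
  by rewrite mulVf ?mul1r// gt_eqF// powR_gt0.
have aS2 k : (b k.+1 * fine (@lebesgue_measure R (I k.+1)) `^ (- 2^-1)) ^+ 2 =
    (k.+1%:R `^ alpha)^-1.
  rewrite aE exprVn -powR_mulrn ?powR_ge0// -powRrM.
  by congr ((_ `^ _)^-1); lra.
have le_a k m : (k <= m)%N ->
    (m.+1%:R `^ (alpha / 2))^-1 <= (k.+1%:R `^ (alpha / 2))^-1 :> R.
  move=> km; rewrite lef_pV2 ?posrE ?powR_gt0//.
  by rewrite ge0_ler_powR ?nnegrE ?ler_nat//; lra.
split.
  apply: (chain_L2_sum hD hI0 lenI0 hI (b := b)) => k; rewrite aE.
  rewrite ger0_norm ?invr_ge0 ?powR_ge0//; case: k => [|k].
    by rewrite powR0 ?invr0//; apply/eqP; lra.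
  by apply: (le_trans (le_a 0%N k _)); rewrite // powR1 invr1.
move=> f sumf; split.
  have [M hM] := powR_series_bounded a1.
  apply: (chain_Hhalf hD hI0 lenI0 hI (b := b) sumf (M := M)) => n.
  by under eq_bigr do rewrite aS2.
move=> Hf2.
have [|k m km|M hM] := chain_sqr_Hhalf hD hI0 lenI0 hI (b := b) sumf _ _ Hf2.
- by move=> k; rewrite aE invr_ge0 powR_ge0.
- by rewrite !aE; exact: le_a.
have a0 : 0 < alpha by lra.
apply: (powR_series_unbounded a0 a32); exists M => n.
by under eq_bigr do rewrite -aS2.
Qed.
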